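(* When $n$ is large there exists a graph $G$ of order $n$ such that $$ \gamma_g(G)\ge\frac{\ln(\delta'+1)+\ln 2+1}{\delta'+1}\,n\,(1+o(1)), $$ where $\delta'=\min\{\delta(G),\delta(\overline{G})\}$ and $o(1)$ denotes a quantity tending to $0$ as $n\to\infty$.
   Context: All graphs are finite and undirected, without loops or multiple edges. $\delta(G)$ denotes the minimum degree of $G$ and $\overline{G}$ its complement. A set $X\subseteq V(G)$ is a dominating set of $G$ if every vertex not in $X$ is adjacent in $G$ to a vertex in $X$. A set $X\subseteq V(G)$ is a global dominating set of $G$ if it is a dominating set both in $G$ and in $\overline{G}$. The global domination number $\gamma_g(G)$ is the minimum cardinality of a global dominating set of $G$. *)

(* Defs.v *)
From HB Require Import structures.
From mathcomp Require Import all_boot all_order all_algebra.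
From mathcomp Require Import all_classical all_reals all_analysis.

Set Implicit Arguments.
Unset Strict Implicit.
Unset Printing Implicit Defensive.

Record sgraph := SGraph {
  vertex :> finType;
  adj : rel vertex;
  adj_sym : symmetric adj;
  adj_irrefl : irreflexive adj }.

Definition compl_adj (G : sgraph) : rel G := fun u v => (u != v) && ~~ adj u v.

Lemma compl_adj_sym (G : sgraph) : symmetric (@compl_adj G).
Proof. by move=> u v; rewrite /compl_adj eq_sym adj_sym. Qed.

Lemma compl_adj_irrefl (G : sgraph) : irreflexive (@compl_adj G).
Proof. by move=> u; rewrite /compl_adj eqxx. Qed.

Definition compl (G : sgraph) : sgraph :=
  SGraph (@compl_adj_sym G) (@compl_adj_irrefl G).

Definition degree (G : sgraph) (v : G) : nat := #|[set u : G | adj v u]|.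

(* Every degree is less than #|G|, so the initial value #|G| does not affect
   the minimum of a nonempty graph. *)
Definition min_degree (G : sgraph) : nat := \big[minn/#|G|]_(v : G) degree v.

Definition dominating (G : sgraph) (X : {set G}) : bool :=
  [forall v, (v \notin X) ==> [exists u in X, adj v u]].

Definition global_dominating (G : sgraph) (X : {set G}) : bool :=
  dominating X && @dominating (compl G) X.

Lemma global_dominatingT (G : sgraph) : global_dominating [set: G].
Proof. by apply/andP; split; apply/forallP => v; rewrite inE. Qed.

(* The minimum is over a nonempty family, by global_dominatingT. *)
Definition global_domination_number (G : sgraph) : nat :=
  #|[arg min_(X < [set: G] | global_dominating X) #|X|]|.

Definition min_degree2 (G : sgraph) : nat :=
  minn (min_degree G) (min_degree (compl G)).

(* Main.v *)
(* Let k be about sqrt n, so that k -> oo while ln n = O(ln k), and let e -> 0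
   slowly.  Join about (1 - e) n points into a clique A, and attach an independent
   set B of about e n vertices, each adjacent to k points of A; a dominating set
   then yields a transversal, of no larger size, of the k-uniform hypergraph on A
   with edges B.  A given t-set of points misses a proportion at least
   k^-(1-e) of the k-sets when t = (1 - 3e) n ln k / k, and there are at most
   n^t = exp (O (n ln^2 k / k)) such t-sets, so by counting some choice of the
   e n edges has no transversal of size t.  A further disjoint clique on k + 1
   vertices keeps the minimum degree of the complement at least k.  Since
   k -> oo, the constant ln 2 + 1 is absorbed by the factor 1 + o(1). *)
Require Import Defs.
From HB Require Import structures.
From mathcomp Require Import all_boot all_order all_algebra.
From mathcomp Require Import all_classical all_reals all_analysis.
From mathcomp Require Import ring lra zify.
Import Order.TTheory GRing.Theory Num.Theory.
Import numFieldNormedType.Exports.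
Local Open Scope ring_scope.

(** * Counting hypergraphs without small transversals *)

(** Lets the union bound run over functions from ['I_t], [N ^ t] in number when [T] is ['I_N]; their
    ranges also cover sets with fewer than [t] elements. *)
Lemma sub_codom_ffun {T : finType} {t : nat} {X : {set T}} (x0 : T) :
  (#|X| <= t)%N -> exists g : {ffun 'I_t -> T}, {subset X <= codom g}.
Proof.
move=> Xt; exists [ffun i : 'I_t => nth x0 (enum X) i] => x xX.
have xi : (index x (enum X) < #|X|)%N by rewrite cardE index_mem mem_enum.
apply/codomP; exists (Ordinal (leq_trans xi Xt)).
by rewrite ffunE /= nth_index // mem_enum.
Qed.

Lemma card_draws_disjoint {T : finType} (k : nat) (Y : {set T}) :
  #|[set e : {set T} | (#|e| == k) && [disjoint e & Y]]| = 'C(#|T| - #|Y|, k).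
Proof.
have <- : #|~: Y| = (#|T| - #|Y|)%N by rewrite cardsCs finset.setCK.
rewrite -(cards_draws (~: Y) k).
by apply: eq_card => e; rewrite !inE finset.disjoints_subset andbC.
Qed.

(** Union bound: at most [('C(N, k) - 'C(N - t, k)) ^ M] families have all their members meeting the
    range of a given function, so the hypothesis leaves a family that escapes all [N ^ t]
    functions. *)
Lemma exists_unhit_family {N k t M : nat} :
  (0 < N)%N ->
  (N ^ t * ('C(N, k) - 'C(N - t, k)) ^ M < 'C(N, k) ^ M)%N ->
  exists F : 'I_M -> {set 'I_N}, (forall b, #|F b| = k) /\
    forall X : {set 'I_N}, (#|X| <= t)%N -> exists b, [disjoint F b & X].
Proof.
move=> N0 lt_count; set D := [set e : {set 'I_N} | #|e| == k].
pose hit (Y : {set 'I_N}) := [set e : {set 'I_N} | (#|e| == k) && ~~ [disjoint e & Y]].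
pose im (g : {ffun 'I_t -> 'I_N}) := [set x in codom g].
have card_hit g : (#|hit (im g)| <= 'C(N, k) - 'C(N - t, k))%N.
  pose miss := [set e : {set 'I_N} | (#|e| == k) && [disjoint e & im g]].
  have : hit (im g) = D :\: miss.
    by apply/setP => e; rewrite !inE; case: (_ == k); case: [disjoint _ & _].
  move=> ->; rewrite cardsD (finset.setIidPr _); last first.
    by apply/fintype.subsetP => e; rewrite !inE => /andP[].
  rewrite card_draws card_ord leq_sub2l// card_draws_disjoint card_ord.
  apply: leq_bin2l; rewrite leq_sub2l// cardsE.
  by rewrite (leq_trans (leq_image_card _ _))// card_ord.
have [F /familyP DF unhit] : exists2 F : {ffun 'I_M -> {set 'I_N}},
    F \in ffun_on D & forall g, F \notin ffun_on (hit (im g)).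
  apply: contrapT => none; move: lt_count; rewrite ltnNge => /negP; apply.
  have -> : ('C(N, k) ^ M = #|(ffun_on D : {pred {ffun 'I_M -> {set 'I_N}}})|)%N.
    by rewrite card_ffun_on card_draws !card_ord.
  (* If no family escapes, each is counted for at least one [g]; exchange the two sums. *)
  apply: (@leq_trans (\sum_g #|(ffun_on (hit (im g)) : {pred {ffun 'I_M -> {set 'I_N}}})|)).
    rewrite -sum1_card.
    under [leqRHS]eq_bigr do rewrite -sum1_card.
    rewrite (exchange_big_dep xpredT)//= [leqRHS](bigID (ffun_on D : pred _))/=.
    apply: (leq_trans _ (leq_addr _ _)); apply: leq_sum => F DF.
    have [g Fg] : exists g, F \in ffun_on (hit (im g)).
      apply: contrapT => nog; apply: none; exists F => // g.
      by apply/negP => Fg; apply: nog; exists g.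
    by rewrite (bigD1 g).
  rewrite (@leq_trans (\sum_(g : {ffun 'I_t -> 'I_N}) ('C(N, k) - 'C(N - t, k)) ^ M)%N)//.
    apply: leq_sum => g _; rewrite card_ffun_on card_ord.
    by case: (M) => // m; rewrite leq_exp2r.
  by rewrite sum_nat_const card_ffun !card_ord.
exists F; split => [b|X Xt]; first by have := DF b; rewrite inE => /eqP.
have [g Xg] := sub_codom_ffun (Ordinal N0) Xt.
have [b] : exists b, F b \notin hit (im g).
  apply: contrapT => nob; move/negP: (unhit g); apply; apply/familyP => b.
  by apply: contrapT => /negP Fb; apply: nob; exists b.
have := DF b; rewrite !inE => -> /=; rewrite negbK => dis; exists b.
by apply: disjointWr dis; apply/fintype.subsetP => x /Xg xg; rewrite inE.
Qed.

(** * The graph of a hypergraph: degrees and domination *)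

(** The summands are, in order, the points, the hyperedges and the extra clique; the default case
    makes the hyperedges independent and cuts the extra clique off. *)
Definition clique_hypergraph_adj {N M K : nat} (F : 'I_M -> {set 'I_N}) :
    rel ('I_N + 'I_M + 'I_K)%type := fun u v =>
  match u, v with
  | inl (inl a), inl (inl a') => a != a'
  | inl (inl a), inl (inr b) | inl (inr b), inl (inl a) => a \in F b
  | inr c, inr c' => c != c'
  | _, _ => false
  end.

Lemma clique_hypergraph_sym {N M K : nat} (F : 'I_M -> {set 'I_N}) :
  symmetric (@clique_hypergraph_adj N M K F).
Proof. by move=> [[a|b]|c] [[a'|b']|c'] //=; rewrite eq_sym. Qed.

Lemma clique_hypergraph_irrefl {N M K : nat} (F : 'I_M -> {set 'I_N}) :
  irreflexive (@clique_hypergraph_adj N M K F).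
Proof. by move=> [[a|b]|c] //=; rewrite eqxx. Qed.

Definition clique_hypergraph {N M : nat} (K : nat) (F : 'I_M -> {set 'I_N}) : sgraph :=
  SGraph (@clique_hypergraph_sym N M K F) (@clique_hypergraph_irrefl N M K F).

Lemma card_clique_hypergraph {N M K : nat} (F : 'I_M -> {set 'I_N}) :
  #|clique_hypergraph K F| = (N + M + K)%N.
Proof. by rewrite !card_sum !card_ord. Qed.

Lemma leq_min_degree (G : sgraph) (d : nat) :
  (0 < #|G|)%N -> (forall v : G, d <= degree v)%N -> (d <= min_degree G)%N.
Proof.
move=> /card_gt0P[v0 _] dv; rewrite /min_degree.
apply: (big_ind (fun m => d <= m)%N) => [|x y dx dy|v _]; last exact: dv.
  exact: leq_trans (dv v0) (max_card _).
by rewrite leq_min dx.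
Qed.

Lemma leq_degree {G : sgraph} {T : finType} {A : {set T}} {f : T -> G} {v : G} :
  injective f -> (forall x, x \in A -> adj v (f x)) -> (#|A| <= degree v)%N.
Proof.
move=> finj fA; rewrite -(card_imset _ finj); apply: subset_leq_card.
by apply/fintype.subsetP => _ /imsetP[x xA ->]; rewrite inE fA.
Qed.

(** In the graph the three kinds of vertices have degree at least [N - 1], [k] and [K - 1]. In the
    complement the extra clique is joined to everything else, which gives at least [K] or [N]. *)
Lemma min_degree2_clique_hypergraph {N M K k : nat} (F : 'I_M -> {set 'I_N}) :
  (k < N)%N -> (k < K)%N -> (forall b, #|F b| = k) ->
  (k <= min_degree2 (clique_hypergraph K F))%N.
Proof.
move=> kN kK Fk.
have pos : (0 < N + M + K)%N by rewrite addn_gt0 (leq_trans _ kK) ?orbT.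
have injl : injective (fun a : 'I_N => inl (inl a) : clique_hypergraph K F).
  by move=> x y [].
have injr : injective (fun c : 'I_K => inr c : clique_hypergraph K F).
  by move=> x y [].
have co1 n (x : 'I_n) : #|~: [set x]| = n.-1 by rewrite cardsC1 card_ord.
rewrite leq_min; apply/andP; split; apply: leq_min_degree.
- by rewrite card_clique_hypergraph.
- move=> [[a|b]|c].
  + apply: (@leq_trans N.-1); first by case: (N) kN.
    rewrite -(co1 _ a); apply: (leq_degree injl) => x.
    by rewrite !inE /= eq_sym.
  + by rewrite -(Fk b); apply: (leq_degree injl) => x.
  + apply: (@leq_trans K.-1); first by case: (K) kK.
    rewrite -(co1 _ c); apply: (leq_degree injr) => x.
    by rewrite !inE /= eq_sym.
- by rewrite card_clique_hypergraph.
- move=> [u|c].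
  + apply: (@leq_trans #|[set: 'I_K]|); first by rewrite cardsT card_ord ltnW.
    by apply: (@leq_degree (compl _) _ _ _ _ injr) => x _; case: u.
  + apply: (@leq_trans #|[set: 'I_N]|); first by rewrite cardsT card_ord ltnW.
    by apply: (@leq_degree (compl _) _ _ _ _ injl) => x _.
Qed.

(* Trading each chosen hyperedge for one of its points turns a dominating set
   into a transversal of no larger size. *)
Lemma dominating_clique_hypergraph {N M K : nat} {F : 'I_M -> {set 'I_N}}
    {X : {set clique_hypergraph K F}} :
  (forall b, (0 < #|F b|)%N) -> dominating X ->
  exists2 Y : {set 'I_N}, (#|Y| <= #|X|)%N & forall b, ~~ [disjoint F b & Y].
Proof.
move=> F0 /forallP domX.
have [pt ptF] : exists pt : 'I_M -> 'I_N, forall b, pt b \in F b.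
  have Fx b : exists x, x \in F b by apply/card_gt0P.
  by exists (fun b => xchoose (Fx b)) => b; exact: xchooseP.
case: (posnP N) => [N0|N0].
  exists finset.set0; first by rewrite cards0.
  move=> b; suff : (pt b < 0)%N by [].
  by rewrite -[X in (_ < X)%N]N0 ltn_ord.
(* The extra clique goes to an arbitrary point, since its vertices dominate no hyperedge. *)
pose tr (u : clique_hypergraph K F) : 'I_N :=
  match u with
  | inl (inl a) => a | inl (inr b) => pt b | inr _ => Ordinal N0
  end.
exists (tr @: X); first exact: leq_imset_card.
move=> b; apply/pred0Pn.
case: (boolP ((inl (inr b) : clique_hypergraph K F) \in X)) => [bX|bX].
  by exists (pt b); rewrite /= ptF; apply/imsetP; exists (inl (inr b)).
have /implyP/(_ bX)/exists_inP[[[a|//]|//] aX /= aF] := domX (inl (inr b)).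
by exists a; rewrite /= aF; apply/imsetP; exists (inl (inl a)).
Qed.

Lemma global_domination_clique_hypergraph {N M K k t : nat} {F : 'I_M -> {set 'I_N}} :
  (0 < k)%N -> (forall b, #|F b| = k) ->
  (forall X : {set 'I_N}, (#|X| <= t)%N -> exists b, [disjoint F b & X]) ->
  (t < global_domination_number (clique_hypergraph K F))%N.
Proof.
move=> k0 Fk unhit; rewrite /global_domination_number.
case: arg_minnP => [|X /andP[domX _] _]; first exact: global_dominatingT.
have F0 b : (0 < #|F b|)%N by rewrite Fk.
have [Y YX hit] := dominating_clique_hypergraph F0 domX.
rewrite ltnNge; apply/negP => Xt.
have [b] := unhit Y (leq_trans YX Xt).
by move=> dis; have := hit b; rewrite dis.
Qed.

(** * Exponential estimates for the count *)

(** The ratio of the binomials is the product over [j < k] of (N - t - j) / (N - j) = 1 / (1 + t /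
    (N - t - j)), and each factor is at least exp (- t / (N - t - k)). *)
Lemma bin_subn_ge {R : realType} {N t k : nat} : (t + k < N)%N ->
  'C(N, k)%:R * expR (- (k%:R * t%:R / (N - t - k)%:R)) <= 'C(N - t, k)%:R :> R.
Proof.
move=> tkN; set x : R := t%:R / (N - t - k)%:R.
have D0 : 0 < (N - t - k)%:R :> R by rewrite ltr0n -subnDA subn_gt0.
have x0 : 0 <= x by rewrite divr_ge0.
suff ffact j : (j <= k)%N -> (N ^_ j)%:R * expR (- x *+ j) <= ((N - t) ^_ j)%:R :> R.
  rewrite -(@ler_pM2r _ (k`!)%:R) ?ltr0n ?fact_gt0//.
  have -> : - (k%:R * t%:R / (N - t - k)%:R) = - x *+ k :> R.
    by rewrite -mulrA -[RHS]mulr_natl mulrN.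
  rewrite mulrAC -!natrM !bin_ffact; exact: ffact.
elim: j => [_|j IH jk]; first by rewrite !ffactn0 mulr0n expR0 mulr1.
rewrite !ffactnSr !natrM mulrSr expRD mulrACA.
apply: ler_pM; rewrite ?mulr_ge0 ?expR_ge0 ?ler0n ?IH ?(ltnW jk)//.
have jN : (t + j <= N)%N by rewrite (leq_trans _ (ltnW tkN))// leq_add2l ltnW.
rewrite expRN -ler_pdivlMr ?invr_gt0 ?expR_gt0// invrK.
have jD : (N - t - k)%:R <= (N - t - j)%:R :> R by rewrite ler_nat leq_sub2l// ltnW.
have -> : (N - j)%:R = (N - t - j)%:R + t%:R :> R.
  by rewrite -natrD; congr (_%:R); lia.
apply: (@le_trans _ _ ((N - t - j)%:R * (1 + x))); last first.
  by rewrite ler_wpM2l// expR_ge1Dx.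
by rewrite mulrDr mulr1 lerD2l /x mulrCA ler_peMr// ler_pdivlMr// mul1r.
Qed.

(** With [p] bounding from below the proportion of k-sets that miss a t-set, 1 - p <= exp (- p)
    bounds the ratio of the two sides by exp (t ln N - M p) < 1. *)
Lemma unhit_count {R : realType} {N k t M : nat} : (t + k < N)%N ->
  t%:R * ln N%:R < M%:R * expR (- (k%:R * t%:R / (N - t - k)%:R)) :> R ->
  (N ^ t * ('C(N, k) - 'C(N - t, k)) ^ M < 'C(N, k) ^ M)%N.
Proof.
move=> tkN; set p := expR _ => tM.
have C0 : (0 < 'C(N, k))%N by rewrite bin_gt0 (leq_trans _ (ltnW tkN))// leq_addl.
have N0 : 0 < N%:R :> R by rewrite ltr0n; case: (N) tkN.
rewrite -(ltr_nat R) natrM !natrX natrB; last by rewrite leq_bin2l// leq_subr.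
have Cp := @bin_subn_ge R _ _ _ tkN.
have step : 'C(N, k)%:R - 'C(N - t, k)%:R <= 'C(N, k)%:R * expR (- p) :> R.
  apply: (@le_trans _ _ ('C(N, k)%:R * (1 + - p))); last first.
    by rewrite ler_wpM2l// expR_ge1Dx.
  by rewrite mulrDr mulr1 mulrN lerD2l lerN2.
apply: (@le_lt_trans _ _ (expR (t%:R * ln N%:R) * ('C(N, k)%:R * expR (- p)) ^+ M)).
  rewrite mulrC [leRHS]mulrC expRM_natl lnK//.
  apply: ler_wpM2r; first by rewrite exprn_ge0// ltW.
  apply: lerXn2r; rewrite ?nnegrE// ?mulr_ge0 ?expR_ge0//.
  by rewrite subr_ge0 ler_nat leq_bin2l// leq_subr.
rewrite exprMn mulrCA -expRM_natl -expRD gtr_pMr ?exprn_gt0 ?ltr0n//.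
by rewrite expR_lt1 mulrN subr_lt0.
Qed.

(** * Real inequalities *)

(** Serves to replace the actual minimum degree, known only to be at least k, by k. The tangent of
    ln at [y] has slope 1 / y <= (ln y + c) / y. *)
Lemma domination_bound_antitone {R : realType} (x y c : R) :
  0 < y -> 1 <= ln y + c -> y <= x -> (ln x + c) / x <= (ln y + c) / y.
Proof.
move=> y0 c1 yx; have x0 : 0 < x := lt_le_trans y0 yx.
rewrite ler_pdivrMr// mulrAC ler_pdivlMr//.
have lnx : ln x <= ln y + (x / y - 1).
  have xy : x = y * (1 + (x / y - 1)).
    by rewrite addrCA subrr addr0 mulrC divfK// gt_eqF.
  have xy0 : 0 < 1 + (x / y - 1) by rewrite addrCA subrr addr0 divr_gt0.
  rewrite {1}xy lnM ?posrE// lerD2l le_ln1Dx//.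
  by rewrite -subr_gt0 opprK addrC.
have : (x / y - 1) * y = x - y by rewrite mulrBl divfK ?gt_eqF// mul1r.
move: lnx c1; set q := x / y - 1; set u := ln y; set v := ln x => h1 h2 h3.
have : (v + c) * y <= (u + q + c) * y by rewrite ler_pM2r// lerD2r.
have : 0 <= (u + c - 1) * (x - y) by rewrite mulr_ge0 ?subr_ge0.
nra.
Qed.

(** All follow from exp x >= 1 + x^3 / 6. Taken at e L with L = ln k, it reduces the last bound to
    36 <= e^4 L, whence the fourth power in the hypothesis. *)
Lemma parameter_bounds {R : realType} {k : nat} {e : R} :
  0 < e <= 1/10 -> 200 <= e ^+ 4 * ln k%:R ->
  [/\ 0 < k%:R :> R, 3 <= e * ln k%:R, ln k%:R + 3 <= e * k%:R &
      6 * ln k%:R ^+ 2 / e < expR (e * ln k%:R)].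
Proof.
move=> /andP[e0 e1] eL; set L := ln k%:R in eL *.
have L0 : 0 < L by rewrite -(@pmulr_rgt0 _ (e ^+ 4)) ?exprn_gt0// (lt_le_trans _ eL).
have k0 : 0 < k%:R :> R.
  by rewrite ltr0n lt0n; apply: contraTneq L0 => k_eq0; rewrite /L k_eq0 ln0// ltxx.
have kE : k%:R = expR L by rewrite lnK.
have e3 : e ^+ 3 <= 1 by rewrite exprn_ile1 ?ltW//; lra.
have eL200 : 200 <= e * L.
  apply: (le_trans eL); rewrite exprSr -mulrA ler_piMl// mulr_ge0 ?ltW//.
have expr3 (x : R) : 0 <= x -> 1 + x ^+ 3 / 6 <= expR x := @expR_ge1Dxn _ x 2.
have L200 : 200 <= L.
  by apply: (le_trans eL200); rewrite ler_piMl ?(ltW L0)//; lra.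
split=> //; first lra.
- rewrite kE; have h := expr3 L (ltW L0).
  have : e * (1 + L ^+ 3 / 6) <= e * expR L by rewrite ler_wpM2l// ltW.
  have : 200 * L ^+ 2 <= e * L * L ^+ 2 by rewrite ler_wpM2r ?sqr_ge0.
  have : 200 * L <= L ^+ 2 by rewrite expr2 ler_wpM2r ?(ltW L0).
  have -> : e * L * L ^+ 2 = e * L ^+ 3 by ring.
  nra.
- have h := expr3 (e * L) (mulr_ge0 (ltW e0) (ltW L0)).
  apply: lt_le_trans h; rewrite ltr_pdivrMr//.
  have : 200 * L ^+ 2 <= e ^+ 4 * L * L ^+ 2 by rewrite ler_wpM2r ?sqr_ge0.
  have -> : (1 + (e * L) ^+ 3 / 6) * e = e + e ^+ 4 * L * L ^+ 2 / 6 by field.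
  have : 0 < L ^+ 2 by rewrite exprn_gt0.
  lra.
Qed.

(** * Choice of the parameters *)

Lemma graph_with_large_global_domination {R : realType} {n k : nat} {e : R} :
  0 < e <= 1/10 -> 200 <= e ^+ 4 * ln k%:R -> (k ^ 2 <= n <= k ^ 3)%N ->
  exists2 G : sgraph, #|G| = n &
    (k <= min_degree2 G)%N /\
    (1 - 4 * e) * (n%:R * ln k%:R / k%:R) <= (global_domination_number G)%:R.
Proof.
move=> e01 eL /andP[kn nk]; have [k0 L3 Lk expL] := parameter_bounds e01 eL.
have /andP[e0 e1] := e01.
set L := ln k%:R in eL L3 Lk expL *.
have L0 : 0 < L.
  by rewrite -(@pmulr_rgt0 _ (e ^+ 4)) ?exprn_gt0// (lt_le_trans _ eL).
have kn' : k%:R * k%:R <= n%:R :> R by rewrite -natrM ler_nat mulnn.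
have n0 : 0 < n%:R :> R by rewrite (lt_le_trans _ kn')// mulr_gt0.
set y := n%:R * L / k%:R.
have yk : y * k%:R = n%:R * L by rewrite /y divfK ?gt_eqF.
have y0 : 0 < y by rewrite /y !(mulr_gt0, invr_gt0).
have ky : k%:R * L <= y.
  by rewrite /y ler_pdivlMr// mulrAC ler_pM2r.
(* Pays for rounding [t] down, turning 1 - 3e into 1 - 4e. *)
have ey : 1 <= e * y.
  have : e * (k%:R * L) <= e * y by rewrite ler_pM2l.
  have : k%:R * 3 <= k%:R * (e * L) by rewrite ler_pM2l.
  have : 1 <= k%:R :> R by rewrite ler1n -(ltr0n R).
  nra.
(* Covers the losses t + 2k + 1 in N - t - k, so that (1 - 2e) n remains. *)
have en : y + 3 * k%:R <= e * n%:R.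
  rewrite -(ler_pM2r k0) mulrDl yk.
  have : n%:R * (L + 3) <= n%:R * (e * k%:R) by rewrite ler_pM2l.
  nra.
have k1 : 1 <= k%:R :> R by rewrite ler1n -(ltr0n R).
have en0 : 0 <= e * n%:R by rewrite mulr_ge0 ?ltW.
pose M := Num.truncn (e * n%:R).
have /andP[Mle Mge] : (M%:R <= e * n%:R < M.+1%:R) := truncn_itv en0.
have ty0 : 0 <= (1 - 3 * e) * y by apply: mulr_ge0; [lra|exact: ltW].
pose t := Num.truncn ((1 - 3 * e) * y).
have /andP[tle tge] : t%:R <= (1 - 3 * e) * y < t.+1%:R := truncn_itv ty0.
have ey0 : 0 < e * y by rewrite mulr_gt0.
have een : e * n%:R <= n%:R / 10.
  by rewrite mulrC ler_pM2l//; lra.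
rewrite -natr1 in Mge; rewrite -natr1 in tge.
have Mkn : (M + k.+1 <= n)%N.
  by rewrite -(ler_nat R) natrD -natr1; lra.
pose N := (n - (M + k.+1))%N.
have NE : N%:R = n%:R - M%:R - k%:R - 1 :> R.
  by rewrite natrB// natrD -natr1; ring.
have tkN : (t + k < N)%N by rewrite -(ltr_nat R) natrD NE; nra.
pose D : R := (N - t - k)%:R.
have DE : D = N%:R - t%:R - k%:R.
  by rewrite /D -subnDA natrB ?natrD; [ring|exact: ltnW].
have Dge : (1 - 2 * e) * n%:R <= D by rewrite DE NE; nra.
have D0 : 0 < D by apply: lt_le_trans Dge; rewrite mulr_gt0//; lra.
(* Rests on 1 - 3e <= (1 - e)(1 - 2e). *)
have expo : k%:R * t%:R / D <= (1 - e) * L.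
  rewrite ler_pdivrMr//.
  have : k%:R * t%:R <= k%:R * ((1 - 3 * e) * y) by rewrite ler_pM2l.
  have -> : k%:R * ((1 - 3 * e) * y) = (1 - 3 * e) * (y * k%:R) by ring.
  rewrite yk => h; apply: (le_trans h).
  have : (1 - e) * L * ((1 - 2 * e) * n%:R) <= (1 - e) * L * D.
    by rewrite ler_pM2l// mulr_gt0//; lra.
  have : 0 <= e ^+ 2 * (n%:R * L) by rewrite !mulr_ge0 ?sqr_ge0 ?(ltW L0) ?(ltW e0) ?ler0n.
  nra.
have lnN : ln N%:R <= 3 * L.
  have N0 : 0 < N%:R :> R by rewrite ltr0n; case: (N) tkN.
  have -> : 3 * L = ln (k%:R ^+ 3) by rewrite lnXn// mulr_natl.
  rewrite ler_ln ?posrE ?exprn_gt0// -natrX ler_nat.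
  by rewrite (leq_trans (leq_subr _ _)).
(* The left side is at most 3 n L^2 / k and the right at least (e n / 2) exp (e L) / k, which leaves
   [expL]. *)
have count : t%:R * ln N%:R < M%:R * expR (- (k%:R * t%:R / D)).
  apply: (@le_lt_trans _ _ (y * (3 * L))).
    apply: (@le_trans _ _ (t%:R * (3 * L))); first by rewrite ler_wpM2l.
    by rewrite ler_pM2r ?mulr_gt0//; nra.
  apply: (@lt_le_trans _ _ (e * n%:R / 2 * expR (- ((1 - e) * L)))); last first.
    by apply: ler_pM; rewrite ?divr_ge0 ?expR_ge0 ?ler_expR ?lerN2//; lra.
  have -> : - ((1 - e) * L) = e * L - L by ring.
  rewrite expRB lnK//.
  have -> : y * (3 * L) = e * n%:R / 2 * ((6 * L ^+ 2 / e) / k%:R).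
    by rewrite /y; field; rewrite !gt_eqF.
  rewrite ltr_pM2l ?divr_gt0 ?mulr_gt0//.
  by rewrite ltr_pM2r ?invr_gt0.
have N0 : (0 < N)%N by case: (N) tkN.
have [F [Fk unhit]] := exists_unhit_family N0 (unhit_count tkN count).
exists (clique_hypergraph k.+1 F).
  by rewrite card_clique_hypergraph -addnA subnK.
split; first by rewrite min_degree2_clique_hypergraph// (leq_ltn_trans _ tkN)// leq_addl.
have k0' : (0 < k)%N by rewrite -(ltr0n R).
have /ltnW := @global_domination_clique_hypergraph _ _ k.+1 _ _ _ k0' Fk unhit.
by rewrite -(ler_nat R) => h; apply: (le_trans _ h); nra.
Qed.

(** * Asymptotics and conclusion *)

Lemma exists_root_between_squares (n : nat) : exists k, (k ^ 2 <= n < k.+1 ^ 2)%N.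
Proof.
elim: n => [|n [k /andP[kn nk]]]; first by exists 0%N.
case: (ltnP n.+1 (k.+1 ^ 2)) => h.
  by exists k; rewrite h (leq_trans kn).
by exists k.+1; rewrite h (leq_ltn_trans nk)// ltn_exp2r.
Qed.

Lemma sqrt_sqrt_expr4 {R : rcfType} {x : R} : 0 <= x -> Num.sqrt (Num.sqrt x) ^+ 4 = x.
Proof.
move=> x0; rewrite -[4%N]/(2 * 2)%N exprM sqr_sqrtr ?sqrtr_ge0//.
by rewrite sqr_sqrtr.
Qed.

Local Open Scope classical_set_scope.

Lemma fourth_root_div_ln_small {R : realType} {a c : R} : 0 < a -> 0 < c ->
  \forall n \near \oo, 0 < ln (n%:R : R) /\ Num.sqrt (Num.sqrt (a / ln n%:R)) <= c.
Proof.
move=> a0 c0; have c40 : 0 < c ^+ 4 by rewrite exprn_gt0.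
exists (Num.truncn (expR (a / c ^+ 4))).+1 => // n /= Nn.
have En : expR (a / c ^+ 4) <= n%:R.
  by rewrite ltW// (lt_le_trans (truncnS_gt _))// ler_nat.
have n0 : 0 < n%:R :> R := lt_le_trans (expR_gt0 _) En.
have lnn : a / c ^+ 4 <= ln n%:R by rewrite -ler_expR lnK.
have ln0 : 0 < ln n%:R :> R by apply: lt_le_trans lnn; rewrite divr_gt0.
split=> //; rewrite -[leRHS]ger0_norm ?(ltW c0)// -sqrtr_sqr ler_sqrt ?sqr_ge0//.
rewrite -[leRHS]ger0_norm ?sqr_ge0// -sqrtr_sqr -exprM ler_sqrt ?(ltW c40)//.
by rewrite ler_pdivrMr// mulrC -ler_pdivrMr.
Qed.

Theorem theorem11 (R : realType) :
  exists2 o1 : nat -> R, o1 @ \oo --> (0 : R) &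
    exists N : nat, forall n : nat, (N <= n)%N ->
      exists2 G : sgraph, #|G| = n &
        let d : R := (min_degree2 G)%:R in
        (ln (d + 1) + ln 2 + 1) / (d + 1) * n%:R * (1 + o1 n)
          <= (global_domination_number G)%:R.
Proof.
(* Makes e^4 ln n = 600, hence e^4 ln k >= 200 once n <= k^3. *)
pose e n : R := Num.sqrt (Num.sqrt (600 / ln n%:R)).
have a0 : 0 < 600 :> R by rewrite ltr0n.
(* Four of the five [e n] come from the graph; the fifth absorbs the additive constant, as 3 <= e
   L. *)
exists (fun n => - (5 * e n)).
  apply/cvgrPdist_le => c c0.
  have c5 : 0 < c / 5 by rewrite divr_gt0.
  have [N _ HN] := fourth_root_div_ln_small a0 c5.
  exists N => // n /HN [_ enc].
  rewrite sub0r opprK ger0_norm ?mulr_ge0 ?sqrtr_ge0// mulrC.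
  by rewrite -ler_pdivlMr.
have c10 : 0 < 1 / 10 :> R by rewrite divr_gt0.
have [N _ HN] := fourth_root_div_ln_small a0 c10.
exists (maxn N 9) => n; rewrite geq_max => /andP[/HN [lnn en1] n9].
have [k /andP[kn nk]] := exists_root_between_squares n.
have k3 : (3 <= k)%N by rewrite -ltnS -(@ltn_exp2r 3 k.+1 2)// (leq_ltn_trans n9).
(* (k + 1)^2 <= k^3 from k = 3 on, which is why n >= 9 is required. *)
have nk3 : (n <= k ^ 3)%N by move: nk; rewrite !expnS expn0; nia.
have k0 : 0 < k%:R :> R by rewrite ltr0n (leq_trans _ k3).
have n0 : 0 < n%:R :> R by rewrite ltr0n (leq_trans _ n9).
have lnk : ln n%:R <= 3 * ln k%:R :> R.
  by rewrite mulr_natl -lnXn// ler_ln ?posrE ?exprn_gt0// -natrX ler_nat.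
have e4 : e n ^+ 4 * ln n%:R = 600.
  by rewrite sqrt_sqrt_expr4 ?(divr_ge0 (ltW a0) (ltW lnn))// divfK ?gt_eqF.
have en0 : 0 < e n by rewrite !sqrtr_gt0 (divr_gt0 a0 lnn).
have eL : 200 <= e n ^+ 4 * ln k%:R.
  have : e n ^+ 4 * ln n%:R <= e n ^+ 4 * (3 * ln k%:R) by rewrite ler_pM2l ?exprn_gt0.
  by rewrite e4 mulrCA; lra.
have e01 : 0 < e n <= 1 / 10 by rewrite en0.
have [G Gn [dk gamma]] : exists2 G : sgraph, #|G| = n &
    (k <= min_degree2 G)%N /\
    (1 - 4 * e n) * (n%:R * ln k%:R / k%:R) <= (global_domination_number G)%:R.
  by apply: graph_with_large_global_domination; rewrite ?kn.
exists G => //=; apply: le_trans gamma.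
have [_ L3 _ _] := parameter_bounds e01 eL.
set L := ln k%:R in L3 *.
have lnk1 : ln (k%:R + 1) <= L + 1 :> R.
  have -> : k%:R + 1 = k%:R * (1 + k%:R^-1) :> R.
    by rewrite mulrDr mulr1 divff ?gt_eqF.
  have ki : 0 < k%:R^-1 :> R by rewrite invr_gt0.
  rewrite lnM ?posrE ?addr_gt0//.
  rewrite lerD2l (le_trans (le_ln1Dx _))//; first lra.
  by rewrite invf_le1// ler1n (leq_trans _ k3).
have ln2 : ln 2 <= 1 :> R by apply: (@le_ln1Dx R 1); lra.
have L0 : 0 < L.
  by rewrite -(@pmulr_rgt0 _ (e n)) ?(lt_le_trans _ L3).
have ln2_0 : 0 <= ln 2 :> R by rewrite ln_ge0//; lra.
have lnk0 : 0 <= ln (k%:R + 1) :> R by rewrite ln_ge0// lerDr ltW.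
set d : R := (min_degree2 G)%:R.
(* The 3 collects ln (k + 1) - L <= 1, ln 2 <= 1 and the constant 1. *)
have bound_d : (ln (d + 1) + ln 2 + 1) / (d + 1) <= (L + 3) / k%:R.
  apply: (@le_trans _ _ ((ln (k%:R + 1) + (ln 2 + 1)) / (k%:R + 1))).
    rewrite -addrA; apply: domination_bound_antitone; [lra|lra|].
    by rewrite lerD2r ler_nat.
  apply: ler_pM; rewrite ?invr_ge0; [lra|lra|lra|].
  by rewrite lef_pV2 ?posrE//; lra.
have /andP[_ e10] := e01.
apply: (@le_trans _ _ ((L + 3) / k%:R * n%:R * (1 - 5 * e n))).
  by rewrite !ler_wpM2r//; lra.
rewrite (_ : (L + 3) / k%:R * n%:R * (1 - 5 * e n) =
  (L + 3) * (1 - 5 * e n) * (n%:R / k%:R)); last by field; rewrite gt_eqF.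
rewrite (_ : (1 - 4 * e n) * _ = (1 - 4 * e n) * L * (n%:R / k%:R)); last first.
  by field; rewrite gt_eqF.
rewrite ler_pM2r ?divr_gt0//.
have : 0 <= e n ^+ 2 * L by rewrite mulr_ge0 ?sqr_ge0// ltW.
nra.
Qed.
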